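(* Let $n$ be a positive integer, let $X_{(0,2)}=X_{(0,4)}=\cdots=X_{(0,2n)}=\infty\in\mathbb{P}^1$, and let $X_{(1,1)},X_{(1,3)},\dots,X_{(1,2n-1)}\in\mathbb{R}\subset\mathbb{P}^1$. Let $A_i$, $i\geq 0$, be the rows of the cross ratio frieze pattern with starting rows $A_0=\{X_{(0,2)},\dots,X_{(0,2n)}\}$ and $A_1=\{X_{(1,1)},\dots,X_{(1,2n-1)}\}$, and suppose that the recursion is well defined for $2n-1$ steps, i.e. that the rows $A_2,\dots,A_{2n}$ are well defined. Then $$X_{(2n-1,k)}=X_{(2n,k+1)}=\frac1n\Big(X_{(1,1)}+X_{(1,3)}+\cdots+X_{(1,2n-1)}\Big)$$ for all $k=1,3,\dots,2n-1$.
   Context: $\mathbb{P}^1=\mathbb{R}\cup\{\infty\}$ is the real projective line. The cross ratio is $[a,b,c,d]=\dfrac{(a-b)(c-d)}{(b-c)(d-a)}$. The relation $[a,b,c,d]=-1$ is understood in the homogeneous, denominator-cleared form $\langle a,b\rangle\langle c,d\rangle+\langle b,c\rangle\langle d,a\rangle=0$, where for points with homogeneous coordinates $a=[a_1:a_2]$, $b=[b_1:b_2]$ one puts $\langle a,b\rangle=a_1b_2-a_2b_1$ (a real number $t$ is $[t:1]$, $\infty=[1:0]$). Cross ratio frieze pattern: each row $A_i$ consists of points $X_{(i,k)}\in\mathbb{P}^1$ with $k\equiv i \pmod 2$, where $k$ is taken modulo $2n$ (so each row is repeated cyclically with $n$ entries). Row $A_{i+1}$ is determined from rows $A_{i-1}$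 and $A_i$ ($i\ge1$) by requiring, for every diamond (i.e. every $k\equiv i+1\pmod 2$), $$[X_{(i-1,k)},\,X_{(i,k-1)},\,X_{(i+1,k)},\,X_{(i,k+1)}]=-1 .$$ Row $A_{i+1}$ is well defined if for every such $k$ there is exactly one point $X_{(i+1,k)}\in\mathbb{P}^1$ satisfying this relation. *)

(* Defs.v *)
From mathcomp Require Import all_boot all_order all_algebra reals.

Set Implicit Arguments.
Unset Strict Implicit.
Unset Printing Implicit Defensive.

Import Order.TTheory GRing.Theory Num.Theory.
Local Open Scope ring_scope.

(* The real projective line R \cup {oo}: [Some t] is the real point t and
   [None] is the point at infinity. *)
Definition P1 (R : realType) : Type := option R.

Definition infty (R : realType) : P1 R := None.
Definition pt (R : realType) (t : R) : P1 R := Some t.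

Definition homog (R : realType) (a : P1 R) : R * R :=
  if a is Some t then (t, 1) else (1, 0).

Definition bracket (R : realType) (a b : P1 R) : R :=
  (homog a).1 * (homog b).2 - (homog a).2 * (homog b).1.

(* The relation [a, b, c, d] = -1 for the cross ratio
   [a, b, c, d] = (a - b)(c - d) / ((b - c)(d - a)), with denominators cleared
   so that it makes sense for all quadruples, including degenerate ones. *)
Definition cross_ratio_m1 (R : realType) (a b c d : P1 R) : Prop :=
  bracket a b * bracket c d + bracket b c * bracket d a = 0.

(* A pattern is a family [X i k]; only the entries with k = i mod 2 are
   meaningful, and the other values are never used.  The column index k modulo
   2n is an integer, together with the periodicity required in [frieze_pattern].
   Only the rows 0, ..., m are constrained, because the recursion may break
   down after row m. *)

Definition diamond (R : realType) (X : nat -> int -> P1 R)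
    (i : nat) (k : int) (Y : P1 R) : Prop :=
  cross_ratio_m1 (X i.-1 k) (X i (k - 1)) Y (X i (k + 1)).

Definition next_row_well_defined (R : realType) (X : nat -> int -> P1 R)
    (i : nat) : Prop :=
  forall k : int, (k = i.+1%:Z %[mod 2])%Z -> exists! Y : P1 R, diamond X i k Y.

Definition frieze_pattern (R : realType) (n m : nat)
    (X : nat -> int -> P1 R) : Prop :=
  (forall (i : nat) (k : int), (i <= m)%N -> (k = i%:Z %[mod 2])%Z ->
     X i (k + (2 * n)%:Z) = X i k) /\
  (forall (i : nat) (k : int), (1 <= i < m)%N -> (k = i.+1%:Z %[mod 2])%Z ->
     diamond X i k (X i.+1 k)).

(* Main.v *)
(* Put S_m = X_(1,2m+1), let E be the shift of sequences, and place at the column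
   k = 2m + i of row i the Pade-type problem: find a nonzero pair (p, s) of a
   polynomial p of degree at most i/2, with p(-1) = 0 when i is even, and a
   scalar s such that p(E)S is equal to s at the indices m, ..., m + j - 1,
   where j is i/2 rounded up.  The claim is that, as long as the recursion is
   well defined, this problem has a solution, unique up to scaling,
   (s, p(1)) is not (0, 0), and X_(i,k) = [s : p(1)].

   For a diamond with corners a (top), b, d (sides), c (bottom), let A, B, D, C
   be the solutions there, and let z act by multiplying p by the variable; z
   changes neither s nor p(1), and changes the sign of p(-1).
   If the bottom row is odd, A(-1) C + C(-1) zA solves the problem of b and
   A(-1) C - C(-1) A that of d; if it is even, C is a combination x B + y zD and
   x B - y D solves the problem of a.  In both cases one pair of opposite
   corners has coordinates u + v, u - v for coordinates u, v of the other pair,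
   which is harmonicity.  A degenerate solution would force a = b = d, which
   well-definedness excludes.

   In rows 2n-1 and 2n the solutions are 1 + z + ... + z^(n-1) and its product
   with 1 + z, because S has period n. *)

Require Import Defs.
From mathcomp Require Import all_boot all_order all_algebra reals.
From mathcomp Require Import zify ring lra.

Set Implicit Arguments.
Unset Strict Implicit.
Unset Printing Implicit Defensive.

Import Order.TTheory GRing.Theory Num.Theory.
Local Open Scope ring_scope.

(** * Polynomials in the shift acting on sequences *)

(** This is p(E)S at index [m], for E the shift of sequences. *)
Definition conv (R : realType) (S : int -> R) (p : {poly R}) (m : int) : R :=
  \sum_(l < size p) p`_l * S (m + l%:Z).

Lemma conv_widen (R : realType) (S : int -> R) (N : nat) (p : {poly R})
  (m : int) : (size p <= N)%N -> conv S p m = \sum_(l < N) p`_l * S (m + l%:Z).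
Proof.
move=> leN; rewrite /conv (big_ord_widen N (fun l => p`_l * S (m + l%:Z)) leN).
rewrite big_mkcond; apply: eq_bigr => l _; case: ltnP => // le_l.
by rewrite nth_default // mul0r.
Qed.

Lemma conv_lin (R : realType) (S : int -> R) (a b : R) (p q : {poly R})
  (m : int) :
  conv S (a *: p + b *: q) m = a * conv S p m + b * conv S q m.
Proof.
set N := maxn (size p) (size q).
have leNs : (size (a *: p + b *: q)%R <= N)%N.
  apply: leq_trans (size_polyD _ _) _; rewrite /N geq_max !leq_max.
  by rewrite !size_scale_leq orbT.
rewrite (@conv_widen _ S N) // (@conv_widen _ S N p) ?leq_maxl //.
rewrite (@conv_widen _ S N q) ?leq_maxr // !mulr_sumr -big_split /=.
by apply: eq_bigr => l _; rewrite coefD !coefZ; ring.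
Qed.

Lemma conv_mulX (R : realType) (S : int -> R) (p : {poly R}) (m : int) :
  conv S ('X * p) m = conv S p (m + 1).
Proof.
rewrite (@conv_widen _ S (size p).+1); last first.
  by apply: leq_trans (size_polyMleq _ _) _; rewrite size_polyX.
rewrite big_ord_recl coefXM mul0r add0r; apply: eq_bigr => l _.
by rewrite coefXM /=; congr (_ * S _); rewrite /bump /= add1n intS addrA.
Qed.

(* Pairs (p, s), with [num], [den], [alt] standing for s, p(1), p(-1). *)
Definition recur (R : realType) : lmodType R := ({poly R} * R^o)%type.

Definition shift (R : realType) (v : recur R) : recur R := ('X * v.1, v.2).

Definition num (R : realType) (v : recur R) : R := v.2.

Definition den (R : realType) (v : recur R) : R := v.1.[1].

Definition alt (R : realType) (v : recur R) : R := v.1.[-1].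

Lemma num_lin (R : realType) a b (u v : recur R) :
  num (a *: u + b *: v) = a * num u + b * num v.
Proof. by []. Qed.

Lemma den_lin (R : realType) a b (u v : recur R) :
  den (a *: u + b *: v) = a * den u + b * den v.
Proof. by rewrite /den /= hornerD !hornerZ. Qed.

Lemma alt_lin (R : realType) a b (u v : recur R) :
  alt (a *: u + b *: v) = a * alt u + b * alt v.
Proof. by rewrite /alt /= hornerD !hornerZ. Qed.

Lemma num_shift (R : realType) (v : recur R) : num (shift v) = num v.
Proof. by []. Qed.

Lemma den_shift (R : realType) (v : recur R) : den (shift v) = den v.
Proof. by rewrite /den /= hornerM hornerX mul1r. Qed.

Lemma alt_shift (R : realType) (v : recur R) : alt (shift v) = - alt v.
Proof. by rewrite /alt /= hornerM hornerX mulN1r. Qed.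

Lemma num0 (R : realType) : num (0 : recur R) = 0.
Proof. by []. Qed.

Lemma den0 (R : realType) : den (0 : recur R) = 0.
Proof. exact: horner0. Qed.

Definition linE := (num_lin, den_lin, alt_lin, num_shift, den_shift, alt_shift).

(* x = [num v : den v]; this holds for every x when both vanish. *)
Definition on_point (R : realType) (x : P1 R) (v : recur R) : Prop :=
  (homog x).1 * den v = (homog x).2 * num v.

(** * The linear problem attached to an entry, and its solution space *)

Definition nondeg (R : realType) (v : recur R) : Prop :=
  ~ (num v = 0 /\ den v = 0).

(** The two bounds are independent: [shift] costs one degree, and advancing the base index costs one
    equation. *)
Definition fits (R : realType) (S : int -> R) (N c : nat) (m : int)
    (v : recur R) : Prop :=
  (size v.1 <= N)%N /\
  forall l : nat, (l < c)%N -> conv S v.1 (m + l%:Z) = num v.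

(** In every row there is one more unknown than linear conditions: with j = [i./2], j + 2 against j
    + 1. In even rows the condition at -1 stands in for one equation. *)
Definition sol (R : realType) (S : int -> R) (i : nat) (m : int)
    (v : recur R) : Prop :=
  fits S i./2.+1 (uphalf i) m v /\ (~~ odd i -> alt v = 0).

Definition good (R : realType) (S : int -> R) (x : P1 R) (i : nat) (m : int) :
    Prop :=
  (exists2 v, sol S i m v & v != 0) /\
  forall v, sol S i m v -> v != 0 -> nondeg v /\ on_point x v.

Lemma fits_lin (R : realType) (S : int -> R) N c m a b u v :
  fits S N c m u -> fits S N c m v -> fits S N c m (a *: u + b *: v).
Proof.
move=> [su cu] [sv cv]; split=> /= [|l ll]; last by rewrite conv_lin cu // cv.
apply: leq_trans (size_polyD _ _) _; rewrite geq_max.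
by rewrite !(leq_trans (size_scale_leq _ _)).
Qed.

Lemma fits_le (R : realType) (S : int -> R) N c N' c' m v :
  (N <= N')%N -> (c' <= c)%N -> fits S N c m v -> fits S N' c' m v.
Proof.
move=> leN lec [sv cv]; split; first exact: leq_trans leN.
by move=> l ll; apply/cv/(leq_trans ll).
Qed.

Lemma fits_shift (R : realType) (S : int -> R) N c m v :
  fits S N c (m + 1) v -> fits S N.+1 c m (shift v).
Proof.
move=> [sv cv]; split=> [|l ll] /=.
  by apply: leq_trans (size_polyMleq _ _) _; rewrite size_polyX.
by rewrite conv_mulX addrAC cv.
Qed.

Lemma fits_tail (R : realType) (S : int -> R) N c m v :
  fits S N c.+1 m v -> fits S N c (m + 1) v.
Proof. by move=> [sv cv]; split=> // l ll; rewrite -addrA -intS cv. Qed.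

Lemma fits_last (R : realType) (S : int -> R) N c m v :
  fits S N c m v -> conv S v.1 (m + c%:Z) = num v -> fits S N c.+1 m v.
Proof.
move=> [sv cv] E; split=> // l; rewrite ltnS leq_eqVlt => /orP[/eqP->//|].
exact: cv.
Qed.

Lemma fits_top (R : realType) (S : int -> R) N c m v :
  fits S N.+1 c m v -> v.1`_N = 0 -> fits S N c m v.
Proof.
move=> [sv cv] z; split=> //; apply/leq_sizeP => l.
by rewrite leq_eqVlt => /orP[/eqP<-//|ltl]; apply: (leq_sizeP _ _ sv).
Qed.

Lemma sol_odd (R : realType) (S : int -> R) j m v :
  sol S j.*2.+1 m v <-> fits S j.+1 j.+1 m v.
Proof.
by rewrite /sol /= uphalf_double odd_double /= doubleK; split=> [[]|].
Qed.

Lemma sol_even (R : realType) (S : int -> R) j m v :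
  sol S j.*2 m v <-> fits S j.+1 j m v /\ alt v = 0.
Proof.
rewrite /sol /= uphalf_double odd_double /= doubleK.
by split=> -[? H]; split=> //; apply: H.
Qed.

Lemma sol_lin (R : realType) (S : int -> R) i m a b u v :
  sol S i m u -> sol S i m v -> sol S i m (a *: u + b *: v).
Proof.
move=> [fu eu] [fv ev]; split; first exact: fits_lin.
by move=> e; rewrite alt_lin eu // ev // !mulr0 addr0.
Qed.

(** * Homogeneous coordinates and harmonic quadruples *)

Lemma homog_on_point (R : realType) (x : P1 R) (v : recur R) :
  nondeg v -> on_point x v ->
  exists c : R, homog x = (c * num v, c * den v).
Proof.
rewrite /nondeg /on_point; case: x => [t|] /= nd.
  rewrite mul1r => E; have nz : den v != 0.
    by apply/eqP => z; apply: nd; rewrite -E z mulr0.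
  by exists (den v)^-1; rewrite -E mulrC mulfK // mulVf.
rewrite mul1r mul0r => E; exists (num v)^-1; rewrite E mulr0 mulVf //.
by apply/eqP => z; apply: nd.
Qed.

Lemma on_point_inj (R : realType) (x y : P1 R) (v : recur R) :
  nondeg v -> on_point x v -> on_point y v -> x = y.
Proof.
move=> nd; rewrite /on_point; case: x => [t|]; case: y => [u|] //=;
  rewrite ?mul1r ?mul0r => E F.
- have nz : den v != 0 by apply/eqP => z; apply: nd; rewrite -E z mulr0.
  by congr Some; apply: (mulIf nz); rewrite E F.
- by case: nd; rewrite -E F mulr0.
- by case: nd; rewrite -F E mulr0.
Qed.

Lemma on_point_exists (R : realType) (v : recur R) :
  exists x : P1 R, on_point x v.
Proof.
case: (eqVneq (den v) 0) => [z|nz].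
  by exists (infty R); rewrite /on_point /= z mulr0 mul0r.
by exists (pt (num v / den v)); rewrite /on_point /= divfK // mul1r.
Qed.

(** Both solutions represent the same point, so a suitable combination of them has [num] and [den]
    zero; [good] then forces it to be zero. *)
Lemma good_proportional (R : realType) (S : int -> R) x i m u v :
  good S x i m -> sol S i m u -> sol S i m v -> v != 0 ->
  exists c : R, u = c *: v.
Proof.
move=> [_ G] su sv nv; have [ndv pv] := G _ sv nv.
case: (eqVneq u 0) => [->|nu]; first by exists 0; rewrite scale0r.
have [ndu pu] := G _ su nu.
have [c Ec] := homog_on_point ndu pu.
have [d Ed] := homog_on_point ndv pv.
have [E1 E2] : c * num u = d * num v /\ c * den u = d * den v.
  by move: Ec; rewrite Ed => -[-> ->].
have nc : c != 0.
  apply/eqP => c0; move: Ec; rewrite c0 !mul0r.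
  by case: (x) => [t|] /=; [move/(congr1 snd)|move/(congr1 fst)] => /= /eqP;
    rewrite oner_eq0.
exists (c^-1 * d); apply/eqP; rewrite -subr_eq0; apply/negP => /negP nz.
have Ew : u - (c^-1 * d) *: v = 1 *: u + (- (c^-1 * d)) *: v.
  by rewrite scale1r scaleNr.
rewrite Ew in nz; have [ndw _] := G _ (sol_lin 1 (- (c^-1 * d)) su sv) nz.
apply: ndw; split; rewrite linE mul1r mulNr -mulrA.
  by rewrite -E1 mulKf ?subrr.
by rewrite -E2 mulKf ?subrr.
Qed.

(** In coordinates [B] and [D] are u + v and u - v, with u along [C] and v along [A]. If one of them
    is zero, its point is arbitrary, but the other is proportional to both [A] and [C], so each
    product of brackets has a zero factor. *)
Lemma cross_ratio_m1_comb (R : realType) (a b c d : P1 R) (A B C D : recur R)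
    (al ga : R) :
  nondeg A -> nondeg C -> (B != 0 -> nondeg B /\ on_point b B) ->
  (D != 0 -> nondeg D /\ on_point d D) -> nondeg B \/ nondeg D ->
  on_point a A -> on_point c C ->
  num B = al * num C + ga * num A -> den B = al * den C + ga * den A ->
  num D = al * num C - ga * num A -> den D = al * den C - ga * den A ->
  cross_ratio_m1 a b c d.
Proof.
move=> nA nC hB hD hBD pA pC B2 B1 D2 D1; rewrite /cross_ratio_m1 /bracket.
have [x ->] := homog_on_point nA pA; have [y ->] := homog_on_point nC pC.
have nd0 (v : recur R) : v = 0 -> ~ nondeg v.
  by move=> -> n; apply: n; rewrite num0 den0.
case: (eqVneq B 0) => [B0|/hB[nB pB]].
  have nD : nondeg D by case: hBD => // /nd0.
  have D0 : D != 0 by apply/eqP => /nd0.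
  have [_ /(homog_on_point nD)[z ->]] := hD D0.
  move: B2 B1; rewrite B0 num0 den0 => E2 E1.
  have F2 : num D = 2 * (al * num C) by rewrite D2; lra.
  have F1 : den D = 2 * (al * den C) by rewrite D1; lra.
  have G2 : num D = - 2 * (ga * num A) by rewrite D2; lra.
  have G1 : den D = - 2 * (ga * den A) by rewrite D1; lra.
  have -> : y * num C * (z * den D) - y * den C * (z * num D) = 0.
    by rewrite F1 F2; ring.
  have -> : z * num D * (x * den A) - z * den D * (x * num A) = 0.
    by rewrite G1 G2; ring.
  by ring.
have [z ->] := homog_on_point nB pB.
case: (eqVneq D 0) => [D0|/hD[nD pD]]; last first.
  by have [w ->] := homog_on_point nD pD; rewrite /= B1 B2 D1 D2; ring.
move: D2 D1; rewrite D0 num0 den0 => E2 E1.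
have F2 : num B = 2 * (al * num C) by rewrite B2; lra.
have F1 : den B = 2 * (al * den C) by rewrite B1; lra.
have G2 : num B = 2 * (ga * num A) by rewrite B2; lra.
have G1 : den B = 2 * (ga * den A) by rewrite B1; lra.
have -> : x * num A * (z * den B) - x * den A * (z * num B) = 0.
  by rewrite G1 G2; ring.
have -> : z * num B * (y * den C) - z * den B * (y * num C) = 0.
  by rewrite F1 F2; ring.
by ring.
Qed.

(** * Solving the problem at the bottom corner of a diamond *)

Lemma nondeg_neq0 (R : realType) (v : recur R) : nondeg v -> v != 0.
Proof. by move=> nd; apply/eqP => E; apply: nd; rewrite E num0 den0. Qed.

(** Here [v] need not solve the problem itself: sharing coordinates with a solution up to a factor
    is enough. This yields the coincidences a = b = d. *)
Lemma good_on_point (R : realType) (S : int -> R) x i m (c : R)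
    (u v : recur R) :
  good S x i m -> sol S i m u -> nondeg v -> c != 0 ->
  num u = c * num v -> den u = c * den v -> on_point x v.
Proof.
move=> [_ G] su nv nc E1 E2; have [|_] := G _ su.
  apply: nondeg_neq0; rewrite /nondeg E1 E2 => -[z1 z2]; apply: nv.
  by split; apply: (mulfI nc); rewrite mulr0.
by rewrite /on_point E1 E2 => E; apply: (mulfI nc); rewrite mulrCA E mulrCA.
Qed.

Lemma good_even (R : realType) (S : int -> R) (xa xb xc xd : P1 R) j m :
  good S xb j.*2.+1 m -> good S xd j.*2.+1 (m + 1) ->
  good S xa j.*2 (m + 1) -> ~ (xa = xb /\ xa = xd) ->
  (forall y, cross_ratio_m1 xa xb y xd -> y = xc) -> good S xc j.+1.*2 m.
Proof.
move=> gb gd ga neq uniq; have n2 : (2 : R) != 0 by rewrite pnatr_eq0.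
have [[b sb nb] gb'] := gb; have [[d sd nd] gd'] := gd.
have [ndb pb] := gb' _ sb nb; have [ndd pd] := gd' _ sd nd.
have fb := (sol_odd S j m b).1 sb; have fd := (sol_odd S j _ d).1 sd.
have fzd := fits_shift fd.
(* Otherwise [shift d] would solve the problem of b and [d + shift d] that of a, so the three points
   would coincide. *)
have top : d.1`_j != 0.
  apply/eqP => z.
  have fzd' : fits S j.+1 j.+1 m (shift d).
    by apply: fits_top fzd _; rewrite /= coefXM.
  have pbd : on_point xb d.
    by apply: (good_on_point gb ((sol_odd S j m _).2 fzd') ndd (oner_neq0 R));
      rewrite !linE mul1r.
  have sa : sol S j.*2 (m + 1) (1 *: d + 1 *: shift d).
    apply/sol_even; split; last by rewrite !linE; ring.
    by apply: fits_lin; [apply: fits_le fd | apply: fits_tail].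
  have pad : on_point xa d.
    by apply: (good_on_point ga sa ndd n2); rewrite !linE; ring.
  apply: neq; rewrite (on_point_inj ndd pad pbd).
  by rewrite -(on_point_inj ndd pbd pd).
split.
  case: (eqVneq (alt b) 0) => [b0|nb0].
    exists b => //; apply/sol_even; split=> //.
    by apply: fits_le fb.
  (* The weights cancel [alt], since [shift] changes its sign. The coefficient of degree j + 1 is
     [alt b] times that of degree j in [d], hence nonzero. *)
  exists (alt d *: b + alt b *: shift d).
    apply/sol_even; split; last by rewrite !linE; ring.
    by apply: fits_lin => //; apply: fits_le fb.
  apply/eqP => /(congr1 (fun v : recur R => v.1`_j.+1)) /=.
  rewrite coefD !coefZ coefXM coef0 /= (leq_sizeP _ _ fb.1) // mulr0 add0r.
  by move/eqP; rewrite mulf_eq0 (negPf nb0) (negPf top).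
move=> C sC nC; have [fC altC] := (sol_even S j.+1 m C).1 sC.
have [x [y EC]] : exists x y : R, C = x *: b + y *: shift d.
  (* This multiple of [shift d] removes the coefficient of degree j + 1 from [C]; the rest solves
     the problem of b, so it is a multiple of [b]. *)
  pose y := C.1`_j.+1 / d.1`_j; pose C' : recur R := 1 *: C + (- y) *: shift d.
  have fC' : fits S j.+1 j.+1 m C'.
    apply: fits_top; first exact: fits_lin.
    by rewrite /= coefD !coefZ coefXM /= /y mulNr divfK // mul1r subrr.
  have [x Ex] := good_proportional gb ((sol_odd S j m _).2 fC') sb nb.
  by exists x, y; rewrite -Ex /C' scale1r scaleNr subrK.
pose A : recur R := y *: d + (- x) *: b.
have altE : x * alt b = y * alt d.
  by move: altC; rewrite EC !linE mulrN => /eqP; rewrite subr_eq0 => /eqP.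
have sA : sol S j.*2 (m + 1) A.
  apply/sol_even; split; last by rewrite !linE mulNr altE subrr.
  by apply: fits_lin; [apply: fits_le fd | apply: fits_tail].
have numC : num C = y * num d + x * num b by rewrite EC !linE addrC.
have denC : den C = y * den d + x * den b by rewrite EC !linE addrC.
(* If [C] has zero coordinates, those of [A] are 2y times those of [d] and -2x times those of [b],
   which gives a = b = d. *)
have ndC : nondeg C.
  move=> [z1 z2]; rewrite z1 in numC; rewrite z2 in denC.
  have nx : x != 0.
    apply/eqP => x0; rewrite x0 !mul0r !addr0 in numC denC.
    have ny : y != 0.
      apply/eqP => y0; move: nC; rewrite EC x0 y0 !scale0r addr0.
      by rewrite eqxx.
    by apply: ndd; split; apply: (mulfI ny); rewrite mulr0.
  have ny : y != 0.
    apply/eqP => y0; rewrite y0 !mul0r !add0r in numC denC.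
    by apply: ndb; split; apply: (mulfI nx); rewrite mulr0.
  have n2' : (- 2 : R) != 0 by rewrite oppr_eq0.
  have pab : on_point xa b.
    by apply: (good_on_point ga sA ndb (mulf_neq0 n2' nx)); rewrite linE; lra.
  have pad : on_point xa d.
    by apply: (good_on_point ga sA ndd (mulf_neq0 n2 ny)); rewrite linE; lra.
  apply: neq; rewrite {1}(on_point_inj ndb pab pb).
  by rewrite (on_point_inj ndd pad pd).
split=> //; have [z pz] := on_point_exists C; rewrite -(uniq z) //.
(* A cyclic shift of the four points only swaps the two products of brackets. *)
suff : cross_ratio_m1 xb z xd xa.
  by move=> E; rewrite /cross_ratio_m1 addrC [X in _ + X]mulrC.
apply: (@cross_ratio_m1_comb _ _ _ _ _ b C d A y x) => //; last 3 first.
- by left.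
- by rewrite !linE; ring.
- by rewrite !linE; ring.
by apply: ga.2.
Qed.

Lemma good_odd (R : realType) (S : int -> R) (xa xb xc xd : P1 R) j m :
  good S xb j.+1.*2 m -> good S xd j.+1.*2 (m + 1) ->
  good S xa j.*2.+1 (m + 1) -> ~ (xa = xb /\ xa = xd) ->
  (forall y, cross_ratio_m1 xa xb y xd -> y = xc) -> good S xc j.+1.*2.+1 m.
Proof.
move=> gb gd ga neq uniq.
have [[A sA nA] ga'] := ga; have [ndA pA] := ga' _ sA nA.
have fA := (sol_odd S j _ A).1 sA; have fzA := fits_shift fA.
(* Otherwise [A] would solve the problem of d and [shift A] that of b, so a = b = d. *)
have al_neq0 : alt A != 0.
  apply/eqP => altA0.
  have sdA : sol S j.+1.*2 (m + 1) A.
    by apply/sol_even; split=> //; apply: fits_le fA.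
  have sbA : sol S j.+1.*2 m (shift A).
    by apply/sol_even; split=> //; rewrite linE altA0 oppr0.
  have pbA : on_point xb A.
    by apply: (good_on_point gb sbA ndA (oner_neq0 R)); rewrite linE mul1r.
  have pdA := (gd.2 _ sdA nA).2.
  by apply: neq; split; [exact: on_point_inj ndA pA pbA|
                         exact: on_point_inj ndA pA pdA].
split.
  have [[b sb nb] _] := gb; have [fb altb] := (sol_even S j.+1 m b).1 sb.
  (* [r] is the defect in the one further equation that the bottom row imposes. *)
  pose r (v : recur R) := conv S v.1 (m + j.+1%:Z) - num v.
  have r_lin x y u v : r (x *: u + y *: v) = x * r u + y * r v.
    by rewrite /r conv_lin linE; ring.
  have fits_r v : fits S j.+2 j.+1 m v -> r v = 0 -> fits S j.+2 j.+2 m v.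
    by move=> fv /eqP; rewrite subr_eq0 => /eqP; apply: fits_last.
  case: (eqVneq (r b) 0) => [rb0|rb_neq0].
    by exists b => //; apply/sol_odd/fits_r.
  (* The weights cancel [r], and [alt] of this combination is [r b * alt A], which is nonzero. *)
  exists (r (shift A) *: b + (- r b) *: shift A).
    by apply/sol_odd/fits_r; [apply: fits_lin | rewrite r_lin; ring].
  apply/eqP => /(congr1 (@alt R)); rewrite !linE altb mulr0 add0r mulrNN.
  by rewrite /alt horner0; apply/eqP; rewrite mulf_neq0.
move=> C sC nC; have fC := (sol_odd S j.+1 m C).1 sC.
pose B : recur R := alt A *: C + alt C *: shift A.
pose D : recur R := alt A *: C + (- alt C) *: A.
have sB : sol S j.+1.*2 m B.
  apply/sol_even; split; last by rewrite !linE; ring.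
  by apply: fits_lin => //; apply: fits_le fC.
have sD : sol S j.+1.*2 (m + 1) D.
  apply/sol_even; split; last by rewrite !linE; ring.
  by apply: fits_lin; [apply: fits_tail | apply: fits_le fA].
(* If [alt C = 0], then [C] solves the problem of b. Otherwise zero coordinates of [C] would make
   [B] and [D] proportional to [A], so a = b = d. *)
have ndC : nondeg C.
  case: (eqVneq (alt C) 0) => [altC0|altC_neq0].
    suff sbC : sol S j.+1.*2 m C by have [] := gb.2 _ sbC nC.
    by apply/sol_even; split=> //; apply: fits_le fC.
  move=> [z1 z2].
  have pbA : on_point xb A.
    by apply: (good_on_point gb sB ndA altC_neq0);
      rewrite !linE ?z1 ?z2 mulr0 add0r.
  have ngA : - alt C != 0 by rewrite oppr_eq0.
  have pdA : on_point xd A.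
    by apply: (good_on_point gd sD ndA ngA); rewrite !linE ?z1 ?z2 mulr0 add0r.
  by apply: neq; split; [exact: on_point_inj ndA pA pbA|
                         exact: on_point_inj ndA pA pdA].
split=> //; have [z pz] := on_point_exists C; rewrite -(uniq z) //.
apply: (@cross_ratio_m1_comb _ _ _ _ _ A B C D (alt A) (alt C)) => //.
- exact: gb.2 _ sB.
- exact: gd.2 _ sD.
(* If both were zero, their sum, with coordinates [2 * alt A] times those of [C], would make [C]
   degenerate. *)
- case: (eqVneq B 0) => [B0|/(gb.2 _ sB)[]]; last by left.
  case: (eqVneq D 0) => [D0|/(gd.2 _ sD)[]]; last by right.
  have n2 : 2 * alt A != 0 by rewrite mulf_neq0 ?pnatr_eq0.
  case: ndC; split; apply: (mulfI n2); rewrite mulr0.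
    by have := num0 R; rewrite -{1}B0; have := num0 R; rewrite -{1}D0 !linE; lra.
  by have := den0 R; rewrite -{1}B0; have := den0 R; rewrite -{1}D0 !linE; lra.
all: by rewrite !linE; ring.
Qed.

(** * The two initial rows and the induction over rows *)

(** A constant vanishing at -1 is zero and there are no equations, so the solutions are the pairs
    (0, s). *)
Lemma good_row0 (R : realType) (S : int -> R) m : good S (infty R) 0 m.
Proof.
split.
  exists ((0, 1) : recur R); last by apply/eqP => /(congr1 snd) /eqP;
    rewrite oner_eq0.
  by apply/(sol_even S 0); split; [split; rewrite //= size_poly0|exact: horner0].
move=> v /(sol_even S 0)[[/size1_polyC]]; move: (v.1`_0) => c E _.
rewrite /on_point /nondeg /den /num /alt E !hornerC => v0 nv.
split; last by rewrite v0 mulr0 mul0r.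
move=> [z _]; move/eqP: nv; apply; rewrite (surjective_pairing v) E v0 z.
by [].
Qed.

(** For a constant p = c the single equation reads c S_m = s. *)
Lemma good_row1 (R : realType) (S : int -> R) m : good S (pt (S m)) 1 m.
Proof.
have convC (c : R) : conv S c%:P m = c * S m.
  rewrite (@conv_widen _ S 1) ?size_polyC_leq1 // big_ord1 coefC eqxx.
  by rewrite addr0.
split.
  exists ((1, S m) : recur R); last by apply/eqP => /(congr1 fst) /eqP;
    rewrite oner_eq0.
  apply/(sol_odd S 0); split=> [|[]//] /=; first by rewrite size_poly1.
  by rewrite addr0 convC mul1r.
move=> v /(sol_odd S 0)[/size1_polyC]; move: (v.1`_0) => c E /(_ 0%N isT).
rewrite addr0 E convC /on_point /nondeg /den E hornerC => Ev nv.
rewrite -Ev; split=> [[z c0]|]; last by rewrite /= mul1r mulrC.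
by move/eqP: nv; apply; rewrite (surjective_pairing v) E -[v.2]/(num v) -Ev c0
  mul0r.
Qed.

Lemma good_next (R : realType) (S : int -> R) (X : nat -> int -> P1 R) i m :
  (forall m, good S (X i (2 * m + i%:Z)) i m) ->
  (forall m, good S (X i.+1 (2 * m + i.+1%:Z)) i.+1 m) ->
  next_row_well_defined X i.+1 ->
  diamond X i.+1 (2 * m + i.+2%:Z) (X i.+2 (2 * m + i.+2%:Z)) ->
  good S (X i.+2 (2 * m + i.+2%:Z)) i.+2 m.
Proof.
move=> ga gb wd dia; set k := 2 * m + i.+2%:Z in dia *.
have [|Y [_ uniqY]] := wd k; first by rewrite /k; lia.
have uniq y : diamond X i.+1 k y -> y = X i.+2 k.
  by move=> dy; rewrite -(uniqY _ dy) -(uniqY _ dia).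
rewrite /diamond /= in uniq.
(* The left side and the bottom of the diamond have index m, the top and the right side m + 1. *)
have Ea : k = 2 * (m + 1) + i%:Z by rewrite /k; lia.
have Eb : k - 1 = 2 * m + i.+1%:Z by rewrite /k; lia.
have Ed : k + 1 = 2 * (m + 1) + i.+1%:Z by rewrite /k; lia.
(* With a = b = d every point satisfies the relation, so infinity and 0 would both complete the
   diamond. *)
have neq : ~ (X i k = X i.+1 (k - 1) /\ X i k = X i.+1 (k + 1)).
  move=> [E1 E2]; rewrite -E1 -E2 in uniq.
  have all_y y : y = X i.+2 k.
    by apply: uniq; rewrite /cross_ratio_m1 /bracket; ring.
  by have := all_y (infty R); rewrite -(all_y (pt 0)).
move: (ga (m + 1)) (gb m) (gb (m + 1)); rewrite -Ea -Eb -Ed.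
have [j [Ei|Ei]] : exists j, i = j.*2 \/ i = j.*2.+1.
- exists i./2; rewrite -{1 3}(odd_double_half i).
  by case: (odd i); [right|left].
- by subst i => g1 g2 g3; apply: good_even g2 g3 g1 neq uniq.
- by subst i => g1 g2 g3; apply: good_odd g2 g3 g1 neq uniq.
Qed.

(** * Periodicity and the last two rows *)

Lemma periodic_modz (T : Type) (f : int -> T) (n : nat) :
  (forall m, f (m + n%:Z) = f m) -> forall m, f m = f (m %% n%:Z)%Z.
Proof.
move=> per m; rewrite {1}(divz_eq m n%:Z) addrC.
elim/int_rect: (m %/ n%:Z)%Z => [|q IH|q IH]; first by rewrite mul0r addr0.
  by rewrite -IH -[RHS]per; congr f; rewrite intS; ring.
by rewrite -IH -[LHS]per; congr f; rewrite intS; ring.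
Qed.

Unset Implicit Arguments.

Theorem theorem1p5 (R : realType) (n : nat) (n_gt0 : (0 < n)%N)
  (X : nat -> int -> P1 R) (x : nat -> R)
  (row0 : forall k : nat, (0 < k <= 2 * n)%N -> ~~ odd k ->
     X 0%N k%:Z = infty R)
  (row1 : forall k : nat, (k < 2 * n)%N -> odd k -> X 1%N k%:Z = pt (x k))
  (frieze : frieze_pattern n (2 * n) X)
  (well_defined : forall i : nat, (1 <= i < 2 * n)%N ->
     next_row_well_defined X i) :
  forall k : nat, (k < 2 * n)%N -> odd k ->
    X (2 * n - 1)%N k%:Z = X (2 * n)%N (k.+1)%:Z /\
    X (2 * n)%N (k.+1)%:Z =
      pt (n%:R^-1 * \sum_(1 <= j < 2 * n | odd j) x j).
Proof.
have [per dia] := frieze.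
(* By [X1] below row 1 is finite, so [S] is that row itself. *)
pose S m := if X 1%N (2 * m + 1) is Some t then t else 0.
have modn (m : int) : (m %% n%:Z)%Z = `|(m %% n%:Z)%Z|%N%:Z.
  by rewrite gez0_abs // modz_ge0 //; lia.
have ltm (m : int) : (`|(m %% n%:Z)%Z| < n)%N.
  by have := ltz_pmod m (d := n%:Z); rewrite {1}modn; lia.
have X0 m : X 0%N (2 * m) = infty R.
  (* The offset 2 matches the residues 0, ..., n - 1 with the given columns 2, ..., 2n. *)
  pose f (m : int) := X 0%N (2 * m + 2).
  have fper q : f (q + n%:Z) = f q.
    by rewrite /f -(per 0%N (2 * q + 2)) //; [congr (X _ _); lia | lia].
  have -> : 2 * m = 2 * (m - 1) + 2 by lia.
  rewrite -/(f (m - 1)) (periodic_modz fper) modn /f.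
  have := ltm (m - 1); set r := `|_|%N => ltr.
  have -> : 2 * r%:Z + 2 = (2 * r + 2)%N%:Z by lia.
  by apply: row0; lia.
have per1 m : X 1%N (2 * (m + n%:Z) + 1) = X 1%N (2 * m + 1).
  by rewrite -(per 1%N (2 * m + 1)); [congr (X _ _); lia | lia | lia].
have X1nat (r : nat) : (r < n)%N -> X 1%N (2 * r%:Z + 1) = pt (x (2 * r).+1).
  move=> ltr; have -> : 2 * r%:Z + 1 = (2 * r).+1%:Z by lia.
  by apply: row1; lia.
have X1 m : X 1%N (2 * m + 1) = pt (S m).
  rewrite /S (periodic_modz (f := fun m => X 1%N (2 * m + 1)) per1) modn.
  by rewrite X1nat.
have Sper m : S (m + n%:Z) = S m by rewrite /S per1.
have G i : (i < 2 * n)%N ->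
    (forall m, good S (X i (2 * m + i%:Z)) i m) /\
    (forall m, good S (X i.+1 (2 * m + i.+1%:Z)) i.+1 m).
  elim: i => [_|i IH lti].
    split=> m; first by rewrite addr0 X0; apply: good_row0.
    by rewrite X1; apply: good_row1.
  have [ga gb] := IH (ltnW lti); split=> // m.
  apply: good_next => //; first exact: well_defined.
  by apply: dia => //; lia.
pose T := \sum_(l < n) S l%:Z.
have sumS m : \sum_(l < n) S (m + l%:Z) = T.
  pose g m := \sum_(l < n) S (m + l%:Z).
  (* Moving the window by one replaces a term by an equal one, as S has period n; so [g] has period
     1. *)
  have gper q : g (q + 1%N%:Z) = g q.
    rewrite /g; case: (n) n_gt0 Sper => // p _ Sp.
    rewrite big_ord_recr [RHS]big_ord_recl /= addr0 addrC -[S q]Sp.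
    congr (S _ + _); first by lia.
    by apply: eq_bigr => l _; congr S; rewrite /bump; lia.
  rewrite -/(g m) (periodic_modz gper) modz1 /g /T.
  by apply: eq_bigr => l _; rewrite add0r.
have n_neq0 : n%:R != 0 :> R by rewrite pnatr_eq0; lia.
(* p(E)S is the sum over a full period and p(1) = n, so [v] represents the mean. *)
pose v : recur R := (\poly_(l < n) 1, T).
have fv m : fits S n n m v.
  split=> [|l _]; first exact: size_poly.
  rewrite (@conv_widen _ S n) ?size_poly // /num /= -(sumS (m + l%:Z)).
  by apply: eq_bigr => r _; rewrite coef_poly ltn_ord mul1r.
have den_v : den v = n%:R.
  rewrite /den horner_poly (eq_bigr (fun=> 1)) ?sumr_const ?card_ord // => l _.
  by rewrite mul1r expr1n.
have nd_v : nondeg v by rewrite /nondeg den_v => -[_ /eqP]; apply/negP.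
have Tx : T = \sum_(1 <= j < 2 * n | odd j) x j.
  transitivity (\sum_(0 <= j < 2 * n | odd j) x j); last first.
    by rewrite big_ltn_cond //; lia.
  rewrite /T; elim: (n) X1nat => [|p IH] X1p; first by rewrite big_ord0 big_geq.
  rewrite big_ord_recr /= IH; last by move=> r ltr; apply: X1p; lia.
  rewrite [RHS]big_mkcond (_ : 2 * p.+1 = (2 * p).+2)%N; last by lia.
  rewrite !big_nat_recr //= -big_mkcond mul2n odd_double /= addr0.
  by rewrite /S X1p // mul2n.
have pv : on_point (pt (n%:R^-1 * T)) v.
  by rewrite /on_point den_v /= mulrAC mulVf.
(* This [m] solves both 2m + 2n - 1 = k and 2m + 2n = k + 1. *)
move=> k ltk oddk; rewrite -Tx; pose m : int := k./2%:Z - n%:Z + 1.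
have Ek : k = (2 * k./2).+1 by have := odd_double_half k; rewrite oddk; lia.
have En : n = n.-1.+1 by rewrite prednK.
have gA : good S (X (2 * n - 1)%N k%:Z) n.-1.*2.+1 m.
  have [|_ /(_ m)] := G (n.-1.*2); first by lia.
  have -> : n.-1.*2.+1 = (2 * n - 1)%N by lia.
  by have -> : 2 * m + (2 * n - 1)%N%:Z = k%:Z by rewrite /m; lia.
have gB : good S (X (2 * n)%N k.+1%:Z) n.*2 m.
  have [|_ /(_ m)] := G (2 * n).-1; first by lia.
  have -> : (2 * n).-1.+1 = (2 * n)%N by lia.
  have -> : 2 * m + (2 * n)%N%:Z = k.+1%:Z by rewrite /m; lia.
  by rewrite mul2n.
have -> : X (2 * n - 1)%N k%:Z = pt (n%:R^-1 * T).
  apply: (on_point_inj nd_v _ pv).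
  apply: (good_on_point gA _ nd_v (oner_neq0 R)); rewrite ?mul1r //.
  by apply/sol_odd; rewrite -En.
have -> : X (2 * n)%N k.+1%:Z = pt (n%:R^-1 * T).
  apply: (on_point_inj nd_v _ pv).
  have n2 : (2 : R) != 0 by rewrite pnatr_eq0.
  (* The factor 1 + z makes p vanish at -1 and doubles both coordinates. *)
  apply: (@good_on_point _ _ _ _ _ 2 (1 *: v + 1 *: shift v) v gB) => //;
    rewrite ?linE; try by ring.
  apply/sol_even; split; last by rewrite !linE; ring.
  by apply: fits_lin; [apply: fits_le (fv m) | apply: fits_shift].
by [].
Qed.
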